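(* Let $f(x,y)$ be a $(p,q)$-invariant complex polynomial defining an algebraic link $K$ in $L_{p,q}$ whose lift is $\widetilde{K}=f^{-1}(0)\cap S^3_\epsilon$, where $0<\epsilon\le\epsilon_0$. Let $t\in[0,2\pi)$ and $F_t=\Psi^{-1}(e^{it})\subset L_{p,q}\setminus K$. Then the boundary of the closure of the surface $F_t$ in $L_{p,q}$ is precisely the link $K$.
   Context: Let $p\ge 1$ and $q$ be coprime integers and let $\zeta\in\mathbb{C}$ be a primitive $p$-th root of unity. Write $S^3_\epsilon=\{(x,y)\in\mathbb{C}^2 : |x|^2+|y|^2=\epsilon^2\}$. The cyclic group $G_{p,q}=\langle\zeta\rangle\cong\mathbb{Z}_p$ acts freely on $S^3_\epsilon$ by $\zeta\cdot(x,y)=(\zeta x,\zeta^q y)$. The lens space is $L_{p,q}=S^3_\epsilon/G_{p,q}$ with quotient map $\pi\colon S^3_\epsilon\to L_{p,q}$, a smooth covering. The lift of a link in $L_{p,q}$ is its preimage under $\pi$. A polynomial $f(x,y)$ is $(p,q)$-invariant if there is an integer $0\le k<p$ with $f(\zeta x,\zeta^q y)=\zeta^k f(x,y)$ for all $(x,y)\in\mathbb{C}^2$. Polynomials are assumed non-constant, with $f(0,0)=0$, and either irreducible or a product of distinct irreducible polynomials. For the given $f$ the links are $\widetilde{K}=f^{-1}(0)\cap S^3_\epsilon$ and $K=\pi(\widetilde{K})$. Set $\overline{p}=p/\gcd(k,p)$ (with $\gcd(0,p)=p$). Let $\Phi\colon S^3_\epsilon\setminus\widetilde{K}\to S^1$,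 $\Phi(x,y)=f(x,y)/|f(x,y)|$, and $\mu(z)=z^{\overline{p}}$ on $S^1$. The map $\Psi\colon L_{p,q}\setminus K\to S^1$ is the well-defined map with $\Psi\circ\pi=\mu\circ\Phi$; each $F_t$ is a smooth surface without boundary in $L_{p,q}\setminus K$. The boundary of the closure of $F_t$ is understood as the boundary of a surface: the set of points of the closure of $F_t$ in $L_{p,q}$ that do not belong to $F_t$. The number $\epsilon_0>0$ (depending on $f$) is one provided by Milnor's theorems: for all $0<\epsilon\le\epsilon_0$, $\widetilde{K}$ is a smooth link in $S^3_\epsilon$, $\Phi$ has no critical points and is the projection of a smooth fiber bundle, and the closure in $S^3_\epsilon$ of each fiber of $\Phi$ is a Seifert surface of $\widetilde{K}$. *)

(* Defs.v *)
From HB Require Import structures.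
From mathcomp Require Import all_boot all_order all_algebra.
From mathcomp Require Import generic_quotient polyXY.
From mathcomp Require Import complex.
From mathcomp Require Import all_classical all_reals all_analysis.

Set Implicit Arguments.
Unset Strict Implicit.
Unset Printing Implicit Defensive.

Import Order.TTheory GRing.Theory Num.Theory.
Import numFieldNormedType.Exports.

Local Open Scope quotient_scope.
Local Open Scope classical_set_scope.
Local Open Scope complex_scope.
Local Open Scope ring_scope.

(* ** Smooth maps and submanifolds, for arbitrary subsets of normed spaces
   (used only with R, R^2, R^4 and products of these). *)

Section Smooth.
Variable R : realType.

(* All iterated directional derivatives up to order k exist and are continuous
   at every point of U (U is meant to be open). *)
Fixpoint Ck (V W : normedModType R) (k : nat) (U : set V) (g : V -> W) : Prop :=
  (forall x, U x -> {for x, continuous g}) /\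
  if k is k'.+1 then
    forall v, (forall x, U x -> derivable g x v) /\ Ck k' U (fun x => 'D_v g x)
  else True.

(* Smoothness on an arbitrary subset: locally the restriction of a C^oo map
   defined on an open set of the ambient space. *)
Definition smooth_on (V W : normedModType R) (A : set V) (g : V -> W) : Prop :=
  forall x, A x -> exists (U : set V) (G : V -> W),
    [/\ open U, U x, forall k, Ck k U G &
        forall y, A y -> U y -> G y = g y].

Definition diffeo (V W : normedModType R) (A : set V) (B : set W)
    (g : V -> W) (h : W -> V) : Prop :=
  [/\ smooth_on A g, smooth_on B h,
      forall x, A x -> B (g x) /\ h (g x) = x &
      forall y, B y -> A (h y) /\ g (h y) = y].

(* Velocities at 0 of smooth curves lying in A for small s >= 0.  For a
   submanifold this is the tangent space at interior points, and the closed
   half of it made of the non-outward vectors at boundary points. *)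
Definition tangent_vector (V : normedModType R) (A : set V) (x w : V) : Prop :=
  exists c : R^o -> V,
    [/\ smooth_on setT c, c 0 = x, A x,
        \forall s \near (0 : R)^'+, A (c s) & 'D_(1 : R^o) c 0 = w].

(* The differential of g at x maps the tangent space of A onto that of B. *)
Definition regular_point (V W : normedModType R) (A : set V) (B : set W)
    (g : V -> W) (x : V) : Prop :=
  forall w', tangent_vector B (g x) w' ->
    exists2 w, tangent_vector A x w & 'D_w g x = w'.

Definition critical_point (V W : normedModType R) (A : set V) (B : set W)
    (g : V -> W) (x : V) : Prop :=
  A x /\ ~ regular_point A B g x.

Definition smooth_fiber_bundle (V W : normedModType R) (A : set V) (B : set W)
    (g : V -> W) : Prop :=
  [/\ smooth_on A g, g @` A = B &
      forall b, B b -> exists (O : set W) (tau : V -> W * V) (sigma : W * V -> V),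
        [/\ open O, O b,
            diffeo (A `&` g @^-1` O)
                   ((B `&` O) `*` (A `&` g @^-1` [set b])) tau sigma &
            forall x, A x -> O (g x) -> (tau x).1 = g x]].

Definition half_plane : set 'rV[R]_2 := [set u | 0 <= u 0 0].

(* A neighbourhood of x in M is parametrised by a relatively open subset of the
   half plane, with x the image of u. *)
Definition surface_chart (V : normedModType R) (M : set V) (x : V)
    (u : 'rV[R]_2) : Prop :=
  exists (O : set V) (U : set 'rV[R]_2) (g : 'rV[R]_2 -> V) (h : V -> 'rV[R]_2),
    [/\ open O /\ O x, open U /\ U u, half_plane u,
        diffeo (U `&` half_plane) (M `&` O) g h & g u = x].

Definition smooth_surface (V : normedModType R) (M : set V) : Prop :=
  forall x, M x -> exists u, surface_chart M x u.

Definition surface_boundary (V : normedModType R) (M : set V) : set V :=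
  [set x | M x /\ exists2 u : 'rV[R]_2, u 0 0 = 0 & surface_chart M x u].

Definition dotv (n : nat) (u v : 'rV[R]_n) : R := \sum_i u 0 i * v 0 i.

(* Orientability of a surface M lying in a 3-sphere centred at 0, expressed by
   a nowhere zero continuous field tangent to the sphere and normal to M. *)
Definition orientable_in_sphere (M : set 'rV[R]_4) : Prop :=
  exists nu : 'rV[R]_4 -> 'rV[R]_4,
    {within M, continuous nu} /\
    forall x, M x ->
      [/\ nu x <> 0, dotv (nu x) x = 0 &
          forall w, tangent_vector M x w -> dotv (nu x) w = 0].

Definition seifert_surface (M L : set 'rV[R]_4) : Prop :=
  [/\ compact M, connected M, smooth_surface M, orientable_in_sphere M &
      surface_boundary M = L].

(* A disjoint union of finitely many, and at least one, smoothly embedded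
   circles R/Z. *)
Definition smooth_link (L : set 'rV[R]_4) : Prop :=
  exists (n : nat) (gamma : 'I_n.+1 -> R^o -> 'rV[R]_4),
    [/\ forall i, smooth_on setT (gamma i),
        forall i s, gamma i (s + 1) = gamma i s,
        forall i s, 'D_(1 : R^o) (gamma i) s <> 0,
        forall i j s s', 0 <= s < 1 -> 0 <= s' < 1 ->
          gamma i s = gamma j s' -> i = j /\ s = s' &
        L = \bigcup_i range (gamma i)].

End Smooth.

Section Lens.
Variable R : realType.

(* R[i]^o is R[i] seen as a normed space over itself; the alias is what gives
   the complex numbers their topology. *)
Local Notation C := (R[i]^o).

Definition coords4 (v : C * C) : 'rV[R]_4 :=
  \row_i [:: complex.Re v.1; complex.Im v.1;
             complex.Re v.2; complex.Im v.2]`_i.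

Definition coords4_inv (w : 'rV[R]_4) : C * C :=
  (w 0 0 +i* w 0 1, w 0 2 +i* w 0 3).

Definition coords2 (z : C) : 'rV[R]_2 :=
  \row_i [:: complex.Re z; complex.Im z]`_i.

Definition S3 (eps : R) : set (C * C) :=
  [set v | `|v.1| ^+ 2 + `|v.2| ^+ 2 = eps%:C ^+ 2].

Definition S1 : set C := [set z | `|z| = 1].

(* f : {poly {poly R[i]}} is f(x, y), with f.[x, y] its value. *)

Definition irreducible2 (g : {poly {poly R[i]}}) : Prop :=
  [/\ g != 0, g \isn't a GRing.unit &
      forall a b, g = a * b -> a \is a GRing.unit \/ b \is a GRing.unit].

Definition associate2 (g h : {poly {poly R[i]}}) : Prop :=
  exists2 u, u \is a GRing.unit & h = u * g.

(* Factors are distinct as irreducibles, i.e. up to nonzero constants. *)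
Definition reduced2 (f : {poly {poly R[i]}}) : Prop :=
  exists s : seq {poly {poly R[i]}},
    [/\ forall g, g \in s -> irreducible2 g,
        forall i j, (i < j < size s)%N -> ~ associate2 s`_i s`_j &
        f = \prod_(g <- s) g].

Definition admissible (f : {poly {poly R[i]}}) : Prop :=
  [/\ ~ (exists c : R[i], f = c%:P%:P), f.[0, 0] = 0 & reduced2 f].

Definition invariant2 (p : nat) (q : int) (zeta : R[i]) (k : nat)
    (f : {poly {poly R[i]}}) : Prop :=
  (k < p)%N /\
  forall x y : R[i], f.[zeta * x, zeta ^ q * y] = zeta ^+ k * f.[x, y].

Definition Ktilde (f : {poly {poly R[i]}}) (eps : R) : set (S3 eps) :=
  [set v | f.[(val v).1, (val v).2] = 0].

Definition Phi (f : {poly {poly R[i]}}) (v : C * C) : C :=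
  f.[v.1, v.2] / `|f.[v.1, v.2]|.

Definition Phi_fiber (f : {poly {poly R[i]}}) (eps : R) (z : C) :
    set (S3 eps) :=
  [set v | ~ Ktilde f v /\ Phi f (val v) = z].

Definition Phi_coords (f : {poly {poly R[i]}}) : 'rV[R]_4 -> 'rV[R]_2 :=
  coords2 \o Phi f \o coords4_inv.

Definition in_coords (eps : R) (A : set (S3 eps)) : set 'rV[R]_4 :=
  (fun v : S3 eps => coords4 (val v)) @` A.

Definition milnor_radius (f : {poly {poly R[i]}}) (eps0 : R) : Prop :=
  0 < eps0 /\
  forall eps : R, 0 < eps <= eps0 ->
    [/\ smooth_link (in_coords (@Ktilde f eps)),
        forall x, ~ critical_point (in_coords (~` @Ktilde f eps))
                                   (coords2 @` S1) (Phi_coords f) x,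
        smooth_fiber_bundle (in_coords (~` @Ktilde f eps))
                            (coords2 @` S1) (Phi_coords f) &
        forall z, S1 z ->
          seifert_surface (in_coords (closure (@Phi_fiber f eps z)))
                          (in_coords (@Ktilde f eps))].

Definition lens_rel (p : nat) (q : int) (zeta : R[i]) (eps : R) :
    rel (S3 eps) :=
  fun v w => [exists j : 'I_p,
    val w == (zeta ^+ j * (val v).1, (zeta ^+ j) ^ q * (val v).2)].

Section Quotient.
Variables (p : nat) (q : int) (zeta : R[i]) (eps : R).
Hypothesis zetaP : p.-primitive_root zeta.

Lemma lens_relP (v w : S3 eps) :
  reflect (exists j : nat,
             val w = (zeta ^+ j * (val v).1, (zeta ^+ j) ^ q * (val v).2))
          (lens_rel p q zeta v w).
Proof.
apply: (iffP existsP) => [[j /eqP ->]|[j ->]]; first by exists j.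
have p0 := prim_order_gt0 zetaP.
by exists (Ordinal (ltn_pmod j p0)); rewrite /= (prim_expr_mod zetaP).
Qed.

Lemma zeta_neq0 : zeta != 0.
Proof.
apply/eqP => z0; have := prim_expr_order zetaP; rewrite z0 expr0n.
by rewrite eqn0Ngt (prim_order_gt0 zetaP) => /esym/eqP; rewrite oner_eq0.
Qed.

Lemma lens_rel_refl : reflexive (@lens_rel p q zeta eps).
Proof.
move=> v; apply/lens_relP; exists 0%N.
by rewrite expr0 exp1rz !mul1r; case: (val v).
Qed.

Lemma lens_rel_trans : transitive (@lens_rel p q zeta eps).
Proof.
move=> w v u /lens_relP[i wE] /lens_relP[j uE]; apply/lens_relP.
exists (j + i)%N; rewrite uE wE /= !mulrA -exprzMl ?unitfE ?expf_neq0 ?zeta_neq0//.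
by rewrite -exprD.
Qed.

Lemma lens_rel_sym : symmetric (@lens_rel p q zeta eps).
Proof.
have rel_sym v w : @lens_rel p q zeta eps v w -> lens_rel p q zeta w v.
  move=> /existsP[j /eqP wE]; apply/lens_relP; exists (p - j)%N.
  have zE : zeta ^+ (p - j) * zeta ^+ j = 1.
    by rewrite -exprD subnK ?(prim_expr_order zetaP)// ltnW.
  rewrite wE /= !mulrA -exprzMl ?unitfE ?expf_neq0 ?zeta_neq0//.
  by rewrite zE exp1rz !mul1r; case: (val v).
by move=> v w; apply/idP/idP; exact: rel_sym.
Qed.

Canonical lens_equiv :=
  EquivRel (@lens_rel p q zeta eps) lens_rel_refl lens_rel_sym lens_rel_trans.

Definition lens_space : Type := quotient_topology {eq_quot lens_equiv}.

HB.instance Definition _ := Topological.on lens_space.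

Definition lens_proj (v : S3 eps) : lens_space :=
  \pi_{eq_quot lens_equiv} v.

Definition lens_repr (l : lens_space) : S3 eps :=
  repr (l : {eq_quot lens_equiv}).

Lemma lens_reprK (l : lens_space) : lens_proj (lens_repr l) = l.
Proof. exact: (@reprK _ {eq_quot lens_equiv}). Qed.

Lemma lens_projP (v w : S3 eps) :
  lens_proj v = lens_proj w <-> lens_rel p q zeta v w.
Proof.
split=> [/(@eqmodP _ lens_equiv v w)//|vw].
exact/(@eqmodP _ lens_equiv v w).
Qed.

Variables (k : nat) (f : {poly {poly R[i]}}).

Definition K_lens : set lens_space := lens_proj @` @Ktilde f eps.

Definition pbar : nat := p %/ gcdn k p.

(* Psi is evaluated on a chosen representative; Psi_proj below shows that it is
   the map determined by Psi \o pi = mu \o Phi.  Only its values off K_lens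
   are meaningful. *)
Definition Psi (l : lens_space) : C := Phi f (val (lens_repr l)) ^+ pbar.

Definition milnor_fiber (t : R) : set lens_space :=
  [set l | ~ K_lens l /\ Psi l = cos t +i* sin t].

Hypothesis finv : invariant2 p q zeta k f.

Lemma invariant2X (j : nat) (x y : R[i]) :
  f.[zeta ^+ j * x, (zeta ^+ j) ^ q * y] = (zeta ^+ j) ^+ k * f.[x, y].
Proof.
case: finv => _ fz; elim: j x y => [|j IH] x y.
  by rewrite !expr0 exp1rz expr1n !mul1r.
rewrite exprS exprzMl ?unitfE ?expf_neq0 ?zeta_neq0// -!mulrA fz IH.
by rewrite mulrA exprMn.
Qed.

Lemma Psi_proj (v : S3 eps) :
  Psi (lens_proj v) = Phi f (val v) ^+ pbar.
Proof.
have /lens_projP/lens_relP[j wE] : lens_proj v = lens_proj (lens_repr (lens_proj v)).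
  by rewrite lens_reprK.
rewrite /Psi /Phi wE /= invariant2X.
have nz : `|zeta| = 1.
  apply/eqP; rewrite -(pexpr_eq1 (prim_order_gt0 zetaP))// -normrX.
  by rewrite (prim_expr_order zetaP) normr1.
rewrite normrM !normrX nz !expr1n mul1r -mulrA exprMn.
suff -> : ((zeta ^+ j) ^+ k) ^+ pbar = 1 by rewrite mul1r.
rewrite -!exprM /pbar; apply/eqP; rewrite -(prim_order_dvd zetaP).
rewrite dvdn_mull// muln_divA ?dvdn_gcdr//.
by rewrite mulnC -muln_divA ?dvdn_gcdl// dvdn_mulr.
Qed.

End Quotient.

End Lens.

(* Main.v *)
Require Import Defs.
From mathcomp Require Import all_boot all_order all_algebra.
From mathcomp Require Import polyXY.
From mathcomp Require Import complex.
From mathcomp Require Import all_classical all_reals all_analysis.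

Import Order.TTheory GRing.Theory Num.Theory.
Import numFieldNormedType.Exports.

Local Open Scope classical_set_scope.
Local Open Scope ring_scope.

(** Off [K] the map [Psi] is continuous, so a limit of points of [F_t] outside
    [K] is still in [F_t].  Conversely, pick a [pbar]-th root [z] of [e^{it}]:
    the projection maps the fiber of [Phi] over [z] into [F_t], and the closure
    of this fiber contains its Seifert boundary, the lift of [K]. *)

Lemma horner2_continuous (K : numFieldType) (T : topologicalType)
    (f : {poly {poly K}}) (x y : T -> K^o) :
  continuous x -> continuous y ->
  continuous ((fun v => f.[(x v : K), (y v : K)]) : T -> K^o).
Proof.
move=> cx cy.
(* The coefficients of [f] are themselves polynomials, evaluated at [y]; they come first, so that
   the induction on [f] only has to deal with powers of [x]. *)
have cc (c : {poly K}) : continuous ((fun v => c.[(y v : K)]) : T -> K^o).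
  elim/poly_ind: c => [|c a IH] v.
    by under eq_fun do rewrite horner0; exact: cst_continuous.
  under eq_fun do rewrite hornerMXaddC.
  apply: (@continuousD K K^o T (fun v => c.[(y v : K)] * y v) (fun=> a)).
    by apply: (@continuousM K T); [exact: IH|exact: cy].
  exact: cst_continuous.
elim/poly_ind: f => [|f c IH] v.
  by under eq_fun do rewrite !horner0; exact: cst_continuous.
under eq_fun do rewrite hornerMXaddC hornerD hornerM hornerC.
apply: (@continuousD K K^o T (fun v => f.[(x v : K), (y v : K)] * x v)
                             (fun v => c.[(y v : K)])); last exact: cc.
by apply: (@continuousM K T); [exact: IH|exact: cx].
Qed.

Lemma coords4K (R : realType) : cancel (@coords4 R) (@coords4_inv R).
Proof. by move=> [[a b] [c d]]; rewrite /coords4_inv !mxE. Qed.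

Lemma in_coordsP (R : realType) (eps : R) (A : set (S3 eps)) (v : S3 eps) :
  in_coords A (coords4 (val v)) -> A v.
Proof. by case=> w Aw /(can_inj (@coords4K R)) /val_inj <-. Qed.

Lemma norm_cos_sin (R : realType) (t : R) : `|(cos t +i* sin t)%C| = 1.
Proof. by rewrite normc_def /= cos2Dsin2 sqrtr1. Qed.

Lemma pbar_gt0 (p k : nat) : (0 < p)%N -> (0 < pbar p k)%N.
Proof.
move=> p0; rewrite /pbar divn_gt0 ?gcdn_gt0 ?p0 ?orbT//.
by rewrite dvdn_leq// dvdn_gcdr.
Qed.

Section LensMilnorFiber.
Variables (R : realType) (p : nat) (q : int) (zeta : R[i]) (k : nat).
Variables (f : {poly {poly R[i]}}) (eps t : R).
Hypotheses (zetaP : p.-primitive_root zeta) (finv : invariant2 p q zeta k f).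

Local Notation proj := (@lens_proj R p q zeta eps zetaP).
Local Notation fval v := f.[(val v).1, (val v).2].

Lemma lens_proj_continuous : continuous proj.
Proof. exact: pi_continuous. Qed.

Lemma open_lens (U : set (lens_space q eps zetaP)) :
  open (proj @^-1` U) -> open U.
Proof. by []. Qed.

(** By invariance [f] changes only by a power of [zeta] along an orbit, so its zero set is a union
    of whole orbits. *)
Lemma K_lens_proj (v : S3 eps) :
  K_lens f (proj v) <-> Ktilde f v.
Proof.
split=> [[w fw /lens_projP/(lens_relP q zetaP)[j vE]]|fv]; last by exists v.
by rewrite /Ktilde /= vE (invariant2X zetaP finv) fw mulr0.
Qed.

Lemma milnor_fiber_proj (v : S3 eps) :
  (milnor_fiber k f t : set (lens_space q eps zetaP)) (proj v) <->
  ~ Ktilde f v /\ Phi f (val v) ^+ pbar p k = (cos t +i* sin t)%C.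
Proof. by rewrite /milnor_fiber /= (Psi_proj zetaP finv) K_lens_proj. Qed.

(** Clearing the denominator replaces an equation in [Phi], a quotient meaningful only off the zeros
    of [f], by the vanishing of an expression continuous on the whole sphere. *)
Lemma Phi_exprE (v : S3 eps) (n : nat) (c : R[i]) : fval v != 0 ->
  (Phi f (val v) ^+ n == c) = (fval v ^+ n - c * `|fval v| ^+ n == 0).
Proof.
move=> fv0; rewrite /Phi expr_div_n subr_eq0.
by rewrite -(inj_eq (mulIf (expf_neq0 n (_ : `|fval v| != 0)))) ?normr_eq0//
  divfK// expf_neq0// normr_eq0.
Qed.

(** Continuity of [Psi] off [K_lens], in the form needed for closures. Openness is tested on the
    sphere, where the preimage is the common nonvanishing locus of two continuous functions: [F] is
    [f], and [G] is the expression of [Phi_exprE]. *)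
Lemma open_off_milnor_fiber :
  open [set l : lens_space q eps zetaP | ~ K_lens f l /\ ~ milnor_fiber k f t l].
Proof.
apply: open_lens.
pose F : S3 eps -> R[i]^o := fun v => fval v.
pose G : S3 eps -> R[i]^o := fun v =>
  F v ^+ pbar p k - (cos t +i* sin t)%C * `|F v| ^+ pbar p k.
have cval : continuous (fun v : S3 eps => val v) by exact: initial_continuous.
have cF : continuous F.
  apply: (@horner2_continuous _ _ f) => v.
  - by apply: continuous_comp; [exact: cval|exact: cvg_fst].
  - by apply: continuous_comp; [exact: cval|exact: cvg_snd].
have cX n (g : S3 eps -> R[i]^o) :
    continuous g -> continuous (fun v => g v ^+ n : R[i]^o).
  move=> cg; elim: n => [|n IH] v; first exact: cst_continuous.
  by under eq_fun do rewrite exprS; apply: (@continuousM R[i] (S3 eps)); [exact: cg|exact: IH].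
have cG : continuous G.
  move=> v; apply: (@continuousB R[i] R[i]^o (S3 eps)
    (fun v => F v ^+ pbar p k) (fun v => _ * `|F v| ^+ pbar p k)).
    exact: cX.
  apply: (@continuousM R[i] (S3 eps)); first exact: cst_continuous.
  apply: (cX _ (fun v => `|F v| : R[i]^o)) => w.
  apply: continuous_comp; first exact: cF.
  exact: norm_continuous.
have -> : proj @^-1` [set l | ~ K_lens f l /\ ~ milnor_fiber k f t l] =
    F @^-1` [set~ 0] `&` G @^-1` [set~ 0].
  apply/seteqP; split=> v /=; rewrite K_lens_proj milnor_fiber_proj /Ktilde /=.
    move=> [/eqP fv0 PhiN]; split; first exact/eqP.
    move=> /eqP; rewrite -Phi_exprE// => /eqP PhiE.
    by apply: PhiN; split=> //; exact/eqP.
  move=> [/eqP fv0 GN]; split; first exact/eqP.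
  by move=> [_ /eqP]; rewrite Phi_exprE// => /eqP.
have oC : open [set~ (0 : R[i]^o)].
  by apply: closed_openC; apply: accessible_closed_set1;
  apply: hausdorff_accessible; exact: norm_hausdorff.
by apply: openI; [move/continuousP: cF|move/continuousP: cG]; apply.
Qed.

Lemma closure_milnor_fiber_sub :
  closure (milnor_fiber k f t : set (lens_space q eps zetaP)) `<=`
  milnor_fiber k f t `|` K_lens f.
Proof.
move=> l cl; rewrite /setU /=.
have [|lF] := pselect (milnor_fiber k f t l); first by left.
right; apply: contrapT => lK.
by have /cl[l' [l'F []]] :=
  open_nbhs_nbhs (conj open_off_milnor_fiber (conj lK lF)).
Qed.

(** The choice of [z] makes [proj] carry the fiber of [Phi] over [z] into the fiber of [Psi], and
    continuity of [proj] passes this to closures. *)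
Lemma closure_Phi_fiber_proj (z : R[i]) (v : S3 eps) :
  z ^+ pbar p k = (cos t +i* sin t)%C -> closure (@Phi_fiber R f eps z) v ->
  closure (milnor_fiber k f t : set (lens_space q eps zetaP)) (proj v).
Proof.
move=> zE cv B /lens_proj_continuous /cv[w [[fw PhiE] Bw]].
by exists (proj w); split=> //; apply/milnor_fiber_proj; rewrite PhiE.
Qed.

End LensMilnorFiber.

Theorem lemma3p10 (R : realType) (p : nat) (q : int) (zeta : R[i])
    (k : nat) (f : {poly {poly R[i]}}) (eps0 eps t : R)
    (hp : (1 <= p)%N) (hpq : coprimez p%:Z q)
    (hzeta : p.-primitive_root zeta)
    (hf : admissible f) (hinv : invariant2 p q zeta k f)
    (heps0 : milnor_radius f eps0) (heps : 0 < eps <= eps0)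
    (ht : 0 <= t < 2 * pi) :
  let F_t : set (lens_space q eps hzeta) := milnor_fiber k f t in
  closure F_t `\` F_t = K_lens f.
Proof.
move=> F_t; apply/seteqP; split=> l.
  by move=> [/(closure_milnor_fiber_sub _ _ _ _ _ _ _ _ _ hinv)[]].
(* [milnor_fiber] excludes [K_lens] by definition, so only membership in the closure remains. *)
move=> lK; split; last by case.
case: lK => v fv <-.
have n0 := pbar_gt0 p k hp.
pose z : R[i] := (pbar p k).-root (cos t +i* sin t)%C.
have zE : z ^+ pbar p k = (cos t +i* sin t)%C by exact: rootCK.
(* The root lies on the unit circle because [pbar] is positive, so the Milnor hypothesis applies to
   the fiber of [Phi] over [z]. *)
have z1 : S1 z.
  by apply/eqP; rewrite -(pexpr_eq1 n0)// -normrX zE norm_cos_sin.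
have [_ /(_ _ heps)[_ _ _ /(_ _ z1)[_ _ _ _ bdE]]] := heps0.
apply: (closure_Phi_fiber_proj _ _ _ _ _ _ _ _ _ hinv _ _ zE); apply: in_coordsP.
have : in_coords (@Ktilde R f eps) (coords4 (val v)) by exists v.
(* [surface_boundary] consists of points of the surface itself, here the closed fiber of [Phi]. *)
by rewrite -bdE => -[].
Qed.
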